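(* Let $k\ge 2$ be an integer, let $c_k := 4\cos^2\frac{\pi}{k+1}$, and let $M=(a_{i,j})$ be a $k\times k$ real matrix with positive entries. (i) If $M\in TP_2(c_k)$, then $\det M\ge 0$. (ii) If $M\in STP_2(c_k)$, then $\det M>0$.
   Context: For $c\ge 1$, $TP_2(c)$ denotes the class of all real matrices $M=(a_{i,j})$ with positive entries such that $a_{i,j}a_{i+1,j+1}\ge c\, a_{i,j+1}a_{i+1,j}$ for all $i,j$ (for which these entries exist). $STP_2(c)$ denotes the class of all real matrices $M=(a_{i,j})$ with positive entries such that $a_{i,j}a_{i+1,j+1}> c\, a_{i,j+1}a_{i+1,j}$ for all $i,j$ (for which these entries exist). *)

(* Defs.v *)
From mathcomp Require Import all_boot all_order all_algebra.
From mathcomp Require Import reals trigo.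
Set Implicit Arguments.
Unset Strict Implicit.
Unset Printing Implicit Defensive.
Import Order.TTheory GRing.Theory Num.Theory.
Local Open Scope ring_scope.

Definition positive_entries (R : realType) (m n : nat) (M : 'M[R]_(m, n)) : Prop :=
  forall i j, 0 < M i j.

(* The successor indices i + 1 and j + 1 are separate ordinals i' and j', so
   the conditions range exactly over the 2 x 2 blocks of adjacent rows and
   columns that fit inside the matrix (no wrap-around at the last index).
   These classes are normally considered for 1 <= c; the bound is not built
   into the definitions. *)
Definition TP2 (R : realType) (c : R) (m n : nat) (M : 'M[R]_(m, n)) : Prop :=
  positive_entries M /\
  forall (i i' : 'I_m) (j j' : 'I_n),
    i' = i.+1 :> nat -> j' = j.+1 :> nat ->
    M i j * M i' j' >= c * (M i j' * M i' j).

Definition STP2 (R : realType) (c : R) (m n : nat) (M : 'M[R]_(m, n)) : Prop :=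
  positive_entries M /\
  forall (i i' : 'I_m) (j j' : 'I_n),
    i' = i.+1 :> nat -> j' = j.+1 :> nat ->
    M i j * M i' j' > c * (M i j' * M i' j).

Definition c_ (R : realType) (k : nat) : R :=
  4 * cos (pi / (k.+1)%:R) ^+ 2.

(* Main.v *)
Require Import Defs.
From mathcomp Require Import all_boot all_order all_algebra.
From mathcomp Require Import reals trigo.
From mathcomp Require Import zify ring lra.
Import Order.TTheory GRing.Theory Num.Theory.
Local Open Scope ring_scope.

(** Why the theorem holds.

    Write [c = 4 cos^2 x] with [x = pi / (k + 1)], and consider first the
    tridiagonal matrix with unit diagonal and off-diagonal products [1 / c].
    Eliminating from the bottom right corner gives the pivots
      [t_0 = 1],  [t_(n+1) = 1 - 1 / (c t_n)],
    which by the addition formulas are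
      [t_n = sin ((n + 2) x) / (2 cos x sin ((n + 1) x))].
    So [t_0, ..., t_(k-2)] are positive and [t_(k-1) = 0]: the constant [c] is
    exactly the one for which the last pivot of a [k] x [k] matrix vanishes.

    A general matrix [M] of the class is compared with this tridiagonal one.
    Let [D_j] be the minor of [M] without row 0 and column [j].  The expansion
    of [det M] along row 0 is the alternating sum of the terms [M_0j D_j]; if
    these decrease with [j], then
      [M_00 D_0 - M_01 D_1 <= det M <= M_00 D_0].
    Applying the upper bound to [D_1] as well gives
      [M_00 D_0 - M_01 M_10 D'' <= det M],
    where [D''] is the minor without the first two rows and columns, as if
    [M] were tridiagonal ([det_three_term_bounds]).  Since
    [c M_01 M_10 <= M_00 M_11] and, by induction, [t_n M_11 D'' <= D_0], this
    becomes [t_(n+1) M_00 D_0 <= det M] for [M] of size [n + 2]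
    ([pivot_bounds_step]), and the last inequality is strict if the condition
    on the top left block is.

    That the terms decrease ([minor_decay]) is a bound on [D_(j+1) / D_j] for an
    [n] x [(n + 1)] matrix, where [D_j] now omits column [j] only.  A three-term
    Pluecker relation ([plucker_three_term]), whose three terms are products of
    nonnegative minors, shows that deleting the first row and the first column
    can only increase this ratio.  Doing so until the gap is between the first
    two columns leaves a ratio that the bounds on determinants control; the
    factor lost there is [1 / t_n], which is at most [c] because
    [t_(n+1) >= 0].  The two families of bounds are therefore proved by one
    simultaneous induction ([pivot_bounds_minor_decay]). *)

(** * Alternating sums and identities between minors *)

Local Notation o1 := (lift ord0 ord0).

Definition corner {T : Type} {m n} (A : 'M[T]_(m.+1, n.+1)) : 'M[T]_(m, n) :=
  row' ord0 (col' ord0 A).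

Lemma alternating_sum_bounds (R : realDomainType) (n : nat) (u : 'I_n.+1 -> R) :
  (forall i, 0 <= u i) ->
  (forall i j : 'I_n.+1, j = i.+1 :> nat -> u j <= u i) ->
  0 <= \sum_(i < n.+1) (-1) ^+ i * u i <= u ord0.
Proof.
elim: n u => [|n IHn] u u_ge0 u_noninc.
  by rewrite big_ord1 expr0 mul1r u_ge0 lexx.
rewrite big_ord_recl expr0 mul1r.
under eq_bigr => i _ do rewrite lift0 exprS mulN1r mulNr.
rewrite sumrN.
have /andP[s_ge0 s_le] := IHn (fun i => u (lift ord0 i)) (fun i => u_ge0 _)
  (fun i j ij => u_noninc (lift ord0 i) (lift ord0 j) (congr1 S ij)).
have u10 := u_noninc ord0 (lift ord0 ord0) erefl.
apply/andP; split; lra.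
Qed.

Lemma row'_col' (T : Type) m n (i : 'I_m) (j : 'I_n) (A : 'M[T]_(m, n)) :
  row' i (col' j A) = col' j (row' i A).
Proof. by apply/matrixP => x y; rewrite !mxE. Qed.

Lemma det_row0 (R : comPzRingType) (n : nat) (M : 'M[R]_n.+1) :
  \det M = \sum_(j < n.+1) (-1) ^+ j * (M ord0 j * \det (col' j (row' ord0 M))).
Proof.
rewrite (expand_det_row M ord0); apply: eq_bigr => j _.
by rewrite /cofactor add0n row'_col' mulrCA.
Qed.

(** Repeating row [i] on top of [A] gives a square matrix with two equal rows;
    the sum is the expansion of its determinant along the new row. *)
Lemma signed_minors_kernel (R : comPzRingType) (n : nat) (A : 'M[R]_(n, n.+1)) i :
  \sum_(k < n.+1) (-1) ^+ k * (A i k * \det (col' k A)) = 0.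
Proof.
pose B : 'M[R]_n.+1 := col_mx (row i A) A.
have rowB : row' ord0 B = A.
  apply/matrixP => x y; rewrite mxE.
  have -> : lift ord0 x = rshift 1 x by apply: val_inj.
  by rewrite [LHS](@col_mxEd _ 1).
have B0 k : B ord0 k = A i k.
  have -> : ord0 = @lshift 1 n ord0 by apply: val_inj.
  by rewrite [LHS](@col_mxEu _ 1) mxE.
have BS k : B (lift ord0 i) k = A i k by rewrite -[RHS](congr1 (fun C : 'M_(_, _) => C i k) rowB) [RHS]mxE.
have detB0 : \det B = 0.
  by apply: (@determinant_alternate _ _ B ord0 (lift ord0 i)) => // k; rewrite B0 BS.
by rewrite -[RHS]detB0 det_row0 rowB; apply: eq_bigr => k _; rewrite B0.
Qed.

(** Pair the kernel vector of signed maximal minors of [A] with the functional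
    [phi] that replaces column [p] of [col' j (corner A)] by a given column:
    [phi] vanishes on the columns that stay in place, so only the columns 0,
    [lift ord0 j] and [lift ord0 j'] of [A] contribute. *)
Lemma plucker_three_term (R : comPzRingType) (n : nat) (A : 'M[R]_(n.+2, n.+3))
    (p : 'I_n.+1) (j j' : 'I_n.+2) (jp : j = p :> nat) (jj' : j' = j.+1 :> nat) :
  \det (col' (lift ord0 j') A) * \det (col' j (corner A))
    + \det (col' ord0 A)
      * \det (col' (lift ord0 p) (col' (lift ord0 j) (row' ord0 A)))
  = \det (col' (lift ord0 j) A) * \det (col' j' (corner A)).
Proof.
rewrite /corner; set A0 := row' ord0 (col' ord0 A).
set K := col' j A0; set X := col' _ (col' _ (row' _ A)).
pose phi k := \sum_r A (lift ord0 r) k * cofactor K r p.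
have syzygy : \sum_(k < n.+3) (-1) ^+ k * (phi k * \det (col' k A)) = 0.
  transitivity (\sum_r cofactor K r p *
      (\sum_(k < n.+3) (-1) ^+ k * (A (lift ord0 r) k * \det (col' k A)))); last first.
    by apply: big1 => r _; rewrite signed_minors_kernel mulr0.
  rewrite (eq_bigr _ (fun r _ => mulr_sumr _ _ _ _)) exchange_big /=.
  apply: eq_bigr => k _; rewrite /phi mulr_suml mulr_sumr.
  by apply: eq_bigr => r _; ring.
have phiK y : phi (lift ord0 (lift j y)) = \det K *+ (y == p).
  transitivity ((\adj K *m K) p y); last by rewrite mul_adj_mx mxE eq_sym.
  by rewrite mxE; apply: eq_bigr => r _; rewrite !mxE mulrC.
(* Column [j'] of [corner A] sits at position [p] once column [j] is gone. *)
have lift_jp : lift j p = j'.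
  by apply: val_inj; rewrite /= /bump jj' jp leqnn.
have phij : phi (lift ord0 j) = \det (col' j' A0).
  rewrite (expand_det_col _ p); apply: eq_bigr => r _.
  congr (_ * _).
    rewrite !mxE; congr (A _ (lift _ _)); apply: val_inj.
    by rewrite /= /bump jj' jp ltnn.
  congr (_ * \det _); apply/matrixP => x y; rewrite !mxE.
  congr (A _ (lift _ _)); apply: val_inj.
  rewrite /= /bump jj' jp; lia.
(* Moving column 0 from position [p] to the front costs [p] transpositions. *)
have phi0 : phi ord0 = (-1) ^+ p * \det X.
  rewrite (expand_det_col X ord0) mulr_sumr; apply: eq_bigr => r _.
  rewrite /cofactor addn0 exprD.
  have -> : X r ord0 = A (lift ord0 r) ord0.
    by rewrite !mxE; congr (A _ _); apply: val_inj.
  have -> : row' r (col' ord0 X) = row' r (col' p K).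
    apply/matrixP => x y; rewrite !mxE.
    by congr (A _ _); apply: val_inj; rewrite /= /bump; lia.
  ring.
have p_sign : (-1) ^+ p * (-1) ^+ p = 1 :> R by rewrite -expr2 sqrr_sign.
move: syzygy; rewrite big_ord_recl phi0 expr0 mul1r.
rewrite (@bigD1_ord _ _ _ _ j) //= phij.
rewrite (bigD1 p) //= big1 ?addr0; last first.
  by move=> y /negPf yp; rewrite phiK yp mul0r mulr0.
rewrite phiK eqxx lift_jp.
have -> : bump 0 (bump j p) = p.+2 by rewrite /bump jp leqnn.
have -> : bump 0 j = p.+1 by rewrite /bump jp.
rewrite !exprS mulr1n => /(congr1 (fun z => (-1) ^+ p * z)); rewrite mulr0.
set s := (-1) ^+ p in p_sign *; set a := \det (col' ord0 A) => E.
apply/eqP; rewrite -subr_eq0; apply/eqP.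
transitivity ((s * s) * (\det (col' (lift ord0 j') A) * \det K + a * \det X
    - \det (col' (lift ord0 j) A) * \det (col' j' A0))).
  by rewrite p_sign mul1r.
by rewrite -[RHS]E; ring.
Qed.

(** * Two-by-two conditions on arbitrary blocks *)

(** Unlike the condition on adjacent rows and columns, the condition on all
    2 x 2 blocks is inherited by submatrices, as the induction requires. *)
Definition wide_TP2 {R : realFieldType} (c : R) {m n : nat} (A : 'M[R]_(m, n)) : Prop :=
  (forall i j, 0 < A i j) /\
  forall (i i' : 'I_m) (j j' : 'I_n), (i < i')%N -> (j < j')%N ->
    c * (A i j' * A i' j) <= A i j * A i' j'.

(** The ratios [g j / f j] grow by a factor [c] at each step, hence, as [c >= 1],
    by at least [c] over any number of steps. *)
Lemma adjacent_ratio_chain (R : realFieldType) (c : R) n (f g : 'I_n -> R) :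
  1 <= c -> (forall j, 0 < f j) -> (forall j, 0 < g j) ->
  (forall j j' : 'I_n, j' = j.+1 :> nat -> c * (f j' * g j) <= f j * g j') ->
  forall j j' : 'I_n, (j < j')%N -> c * (f j' * g j) <= f j * g j'.
Proof.
move=> c1 f0 g0 adj j j' jj'.
have [d] : exists d, (j' = j + d.+1 :> nat)%N by exists (j' - j.+1)%N; lia.
elim: d j' {jj'} => [|d IHd] j' dj'; first by apply: adj; lia.
have kn : (j + d.+1 < n)%N by have := ltn_ord j'; lia.
pose k := Ordinal kn.
have jk := IHd k erefl; have kj' : c * (f j' * g k) <= f k * g j'.
  by apply: adj; rewrite /=; lia.
have fg : 0 < f k * g k by rewrite mulr_gt0.
rewrite -(ler_pM2l fg).
have fj := f0 j; have fj' := f0 j'; have gj := g0 j; have gj' := g0 j'.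
have fk := f0 k; have gk := g0 k.
apply: le_trans (_ : (c * (f k * g j)) * (c * (f j' * g k)) <= _).
  rewrite [leRHS](_ : _ = c * (f k * g k * (c * (f j' * g j)))); last by ring.
  apply: ler_peMl => //; apply: ltW; rewrite !mulr_gt0 //; lra.
apply: le_trans (ler_pM _ _ jk kj') _.
- by apply: ltW; rewrite !mulr_gt0 //; lra.
- by apply: ltW; rewrite !mulr_gt0 //; lra.
- lra.
Qed.

(** Chaining applies first along two adjacent rows, then along two arbitrary
    columns. *)
Lemma wide_TP2_adjacent (R : realFieldType) (c : R) m n (A : 'M[R]_(m, n)) :
  1 <= c -> (forall i j, 0 < A i j) ->
  (forall (i i' : 'I_m) (j j' : 'I_n), i' = i.+1 :> nat -> j' = j.+1 :> nat ->
    c * (A i j' * A i' j) <= A i j * A i' j') ->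
  wide_TP2 c A.
Proof.
move=> c1 A0 adj; split=> // i i' j j' ii' jj'.
rewrite (mulrC (A i j')).
apply: (@adjacent_ratio_chain _ c _ (A^~ j) (A^~ j')) ii' => // {}i {}i' ii'.
rewrite (mulrC (A i' j)).
by apply: (@adjacent_ratio_chain _ c _ (A i) (A i')) jj' => // *; apply: adj.
Qed.

Lemma lift_mono n (h : 'I_n) (i j : 'I_n.-1) : (i < j)%N -> (lift h i < lift h j)%N.
Proof. by move=> ij; rewrite /= /bump; lia. Qed.

Lemma wide_TP2_row' (R : realFieldType) (c : R) m n i (A : 'M[R]_(m.+1, n)) :
  wide_TP2 c A -> wide_TP2 (m := m) c (row' i A).
Proof.
by case=> A0 A2; split=> [x y|x x' y y' xx' yy']; rewrite !mxE //; apply/A2/yy'/lift_mono.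
Qed.

Lemma wide_TP2_col' (R : realFieldType) (c : R) m n j (A : 'M[R]_(m, n.+1)) :
  wide_TP2 c A -> wide_TP2 (n := n) c (col' j A).
Proof.
by case=> A0 A2; split=> [x y|x x' y y' xx' yy']; rewrite !mxE //; apply/A2/lift_mono.
Qed.

Lemma wide_TP2_corner (R : realFieldType) (c : R) m n (A : 'M[R]_(m.+1, n.+1)) :
  wide_TP2 c A -> wide_TP2 c (corner A).
Proof. by move=> A2; apply/wide_TP2_row'/wide_TP2_col'. Qed.

(** * Pivots of the extremal tridiagonal matrix *)

Fixpoint pivot {R : realFieldType} (c : R) (n : nat) : R :=
  if n is n'.+1 then 1 - (c * pivot c n')^-1 else 1.

(** The pivots up to index [n] are those of the tridiagonal comparison matrix of
    size [n + 1]; the last one may vanish, as it does at the critical [c]. *)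
Definition admissible {R : realFieldType} (c : R) (n : nat) : Prop :=
  (forall i, (i < n)%N -> 0 < pivot c i) /\ 0 <= pivot c n.

Lemma admissible_pred (R : realFieldType) (c : R) n :
  admissible c n.+1 -> admissible c n.
Proof.
by case=> t0 _; split=> [i ni|]; [apply: t0; lia | apply/ltW/t0].
Qed.

Lemma admissible_gt0 (R : realFieldType) (c : R) n i :
  admissible c n -> (i < n)%N -> 0 < pivot c i.
Proof. by case=> t0 _ /t0. Qed.

(** This is the recursion for [pivot c n.+1] read backwards. *)
Lemma admissible_mul_ge1 (R : realFieldType) (c : R) n :
  0 < c -> admissible c n.+1 -> 1 <= c * pivot c n.
Proof.
move=> c0 adm; have t0 := admissible_gt0 _ _ _ _ adm (ltnSn n).
have ct0 : 0 < c * pivot c n by rewrite mulr_gt0.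
by case: adm => _ /=; rewrite subr_ge0 invf_le1.
Qed.

(** * Determinant bounds and decay of minors *)

(** The ratio [\det M / \det (corner M)] is the pivot that elimination from the
    bottom right corner leaves in the top left entry.  Its lower bound is the
    comparison with the tridiagonal matrix; its upper bound, of Hadamard-Fischer
    type, serves to bound subtracted minors. *)
Definition pivot_bounds {R : realFieldType} (c : R) (n : nat) : Prop :=
  forall M : 'M[R]_n.+1, wide_TP2 c M ->
  [/\ 0 < \det (corner M),
      \det M <= M ord0 ord0 * \det (corner M)
    & pivot c n * (M ord0 ord0 * \det (corner M)) <= \det M].

(** The factor [c] is exactly what a further row on top of [A] makes up for:
    its entries satisfy [c M_0j' A_0j <= M_0j A_0j'], so that the terms
    [M_0j * \det (col' j A)] decrease. *)
Definition minor_decay {R : realFieldType} (c : R) (n : nat) : Prop :=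
  forall A : 'M[R]_(n.+1, n.+2), wide_TP2 c A ->
  forall j j' : 'I_n.+2, j' = j.+1 :> nat ->
  A ord0 j' * \det (col' j' A) <= c * (A ord0 j * \det (col' j A)).

Lemma det_gt0_pivot (R : realFieldType) (c : R) n (M : 'M[R]_n.+1) :
  pivot_bounds c n -> 0 < pivot c n -> wide_TP2 c M -> 0 < \det M.
Proof.
move=> P t0 M2; have [m0 _] := P _ M2; apply: lt_le_trans.
by rewrite !mulr_gt0 //; case: M2.
Qed.

Lemma corner_col1 (T : Type) m n (A : 'M[T]_(m.+1, n.+2)) :
  corner (col' o1 A) = corner (col' ord0 A).
Proof.
by apply/matrixP => x y; rewrite !mxE; congr (A _ _); apply: val_inj.
Qed.

(** Along row 0 the determinant is an alternating sum of decreasing terms.  It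
    is thus at most its first term and at least the difference of its first two;
    the upper bound for smaller determinants applies to the minor in the second
    term. *)
Lemma det_three_term_bounds (R : realFieldType) (c : R) n (M : 'M[R]_n.+2) :
  1 <= c -> 0 < pivot c n -> pivot_bounds c n -> minor_decay c n ->
  wide_TP2 c M ->
  M ord0 ord0 * \det (corner M)
    - M ord0 o1 * M o1 ord0 * \det (corner (corner M)) <= \det M
  <= M ord0 ord0 * \det (corner M).
Proof.
move=> c1 t0 P Q M2; set A := row' ord0 M.
have A2 : wide_TP2 c A by apply: wide_TP2_row'.
have M0 := M2.1.
have D0 k : 0 < \det (col' k A).
  by apply: (det_gt0_pivot _ _ _ _ P t0); apply: wide_TP2_col'.
pose u k := M ord0 k * \det (col' k A).
have u_ge0 k : 0 <= u k by rewrite ltW // mulr_gt0.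
have u_noninc (i j : 'I_n.+2) : j = i.+1 :> nat -> u j <= u i.
  move=> ij; rewrite /u.
  have A0j : 0 < A ord0 j by apply: A2.1.
  have A0i : 0 < A ord0 i by apply: A2.1.
  (* Multiply by [A ord0 j] to chain [minor_decay] with the 2 x 2 condition. *)
  rewrite -(ler_pM2l A0j).
  have Qij := Q A A2 i j ij.
  have Mij : c * (M ord0 j * A ord0 i) <= M ord0 i * A ord0 j.
    by rewrite !mxE; apply: M2.2; rewrite ?ij.
  have := ler_pM2l (M0 ord0 j) (A ord0 j * \det (col' j A)) (c * (A ord0 i * \det (col' i A))).
  rewrite Qij => h1.
  have := ler_pM2r (D0 i) (c * (M ord0 j * A ord0 i)) (M ord0 i * A ord0 j).
  rewrite Mij => h2.
  lra.
have detM : \det M = \sum_(j < n.+2) (-1) ^+ j * u j by exact: det_row0.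
have cornerE : corner M = col' ord0 A by rewrite /corner row'_col'.
have /andP[_ upper] := alternating_sum_bounds _ _ u u_ge0 u_noninc.
have /andP[_ lower] := alternating_sum_bounds _ _ (fun i => u (lift ord0 i))
  (fun i => u_ge0 _) (fun i j ij => u_noninc (lift ord0 i) (lift ord0 j) (congr1 S ij)).
rewrite detM cornerE upper andbT big_ord_recl expr0 mul1r.
under eq_bigr => i _ do rewrite lift0 exprS mulN1r mulNr.
rewrite sumrN lerD2l lerN2; apply: le_trans lower _.
have [_ + _] := P _ (wide_TP2_col' _ _ _ _ o1 _ A2).
rewrite corner_col1 /u -mulrA ler_pM2l ?M0 //.
by rewrite !mxE (_ : lift o1 ord0 = ord0) //; apply: val_inj.
Qed.

(** By the three-term bound and [c M_01 M_10 <= M_00 M_11], the part lost from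
    [M_00 D_0] is at most [M_00 M_11 D'' / c], and [M_11 D''] is at most
    [D_0 / pivot c n]. *)
Lemma pivot_bounds_step (R : realFieldType) (c : R) n :
  1 <= c -> 0 < pivot c n -> pivot_bounds c n -> minor_decay c n ->
  pivot_bounds c n.+1.
Proof.
move=> c1 t0 P Q M M2; have C2 := wide_TP2_corner _ _ _ _ _ M2.
have /andP[lower upper] := det_three_term_bounds _ _ _ _ c1 t0 P Q M2.
split=> //; first exact: (det_gt0_pivot _ _ _ _ P t0).
apply: le_trans lower; rewrite /= mulrBl mul1r lerD2l lerN2.
have [D0 _ lowC] := P _ C2.
have C00 : corner M ord0 ord0 = M o1 o1 by rewrite !mxE.
have ct0 : 0 < c * pivot c n by rewrite mulr_gt0 //; lra.
rewrite ler_pdivlMl //.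
rewrite C00 in lowC.
have h1 := ler_wpM2l (ltW (M2.1 ord0 ord0)) lowC.
apply: le_trans h1.
have h2 : c * (M ord0 o1 * M o1 ord0) <= M ord0 ord0 * M o1 o1 by apply: M2.2.
have tD : 0 <= pivot c n * \det (corner (corner M)) by rewrite ltW // mulr_gt0.
have := ler_wpM2r tD h2; lra.
Qed.

(** The two minors share the corner minor [D], so that one is at most [A_00 D]
    and the other at least [pivot c n * A_01 D]; [c * pivot c n >= 1] closes the
    gap. *)
Lemma minor_decay_first (R : realFieldType) (c : R) n (A : 'M[R]_(n.+1, n.+2)) :
  0 < c -> admissible c n.+1 -> pivot_bounds c n -> wide_TP2 c A ->
  A ord0 o1 * \det (col' o1 A) <= c * (A ord0 ord0 * \det (col' ord0 A)).
Proof.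
move=> c0 adm P A2.
have ct1 := admissible_mul_ge1 _ _ _ c0 adm.
have [D0 _ low] := P _ (wide_TP2_col' _ _ _ _ ord0 _ A2).
have [_ upp _] := P _ (wide_TP2_col' _ _ _ _ o1 _ A2).
rewrite corner_col1 in upp.
have e0 : (col' ord0 A : 'M_n.+1) ord0 ord0 = A ord0 o1 by rewrite mxE.
have e1 : (col' o1 A : 'M_n.+1) ord0 ord0 = A ord0 ord0.
  by rewrite mxE; congr (A _ _); apply: val_inj.
rewrite e0 in low; rewrite e1 in upp.
have a0 := A2.1 ord0 ord0; have ao := A2.1 ord0 o1.
move: low upp D0; set D := \det (corner _) => low upp D0.
have h1 := ler_wpM2l (ltW ao) upp.
have ca : 0 < c * A ord0 ord0 by rewrite mulr_gt0.
have h2 := ler_wpM2l (ltW ca) low.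
have aaD : 0 < A ord0 ord0 * A ord0 o1 * D by rewrite !mulr_gt0.
have h3 := ler_wpM2l (ltW aaD) ct1.
lra.
Qed.

(** For [j > 0], the positivity of the middle Pluecker product gives
    [D_j' / D_j <= S_x' / S_x] with [S] the minors of [corner A]; induction bounds
    the latter ratio by row 1 of [A], and passing from row 1 to row 0 only
    helps since [c >= 1]. *)
Lemma minor_decay_step (R : realFieldType) (c : R) n :
  1 <= c -> admissible c n.+2 -> pivot_bounds c n -> pivot_bounds c n.+1 ->
  minor_decay c n -> minor_decay c n.+1.
Proof.
move=> c1 adm P P' Q A A2 j j' jj'.
have c0 : 0 < c by lra.
case: (unliftP ord0 j) => [x jx|j0]; last first.
  have -> : j' = o1 by apply: val_inj; rewrite /= jj' j0.
  by rewrite j0; apply: minor_decay_first.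
case: (unliftP ord0 j') => [x' jx'|j'0]; last by rewrite j'0 in jj'.
have xx' : x' = x.+1 :> nat by move: jj'; rewrite jx jx' !lift0 => -[].
have xn : (x < n.+1)%N by have := ltn_ord x'; rewrite xx'.
have := @plucker_three_term _ _ A (Ordinal xn) x x' erefl xx'.
rewrite -jx -jx'.
have t0 : 0 < pivot c n by apply: (admissible_gt0 _ _ _ _ adm).
have t1 : 0 < pivot c n.+1 by apply: (admissible_gt0 _ _ _ _ adm).
have big_pos k : 0 < \det (col' k A).
  by apply: (det_gt0_pivot _ _ _ _ P' t1); apply: wide_TP2_col'.
have C2 := wide_TP2_corner _ _ _ _ _ A2.
have small_pos k : 0 < \det (col' k (corner A)).
  by apply: (det_gt0_pivot _ _ _ _ P t0); apply: wide_TP2_col'.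
set X := \det (col' (lift ord0 (Ordinal xn)) _).
have X0 : 0 < X.
  apply: (det_gt0_pivot _ _ _ _ P t0).
  by do 2!apply: wide_TP2_col'; apply: wide_TP2_row'.
have B0 := big_pos ord0.
have Bj := big_pos j; have Bj' := big_pos j'.
have Sx := small_pos x; have Sx' := small_pos x'.
have Qx := Q _ C2 x x' xx'.
have Cx : corner A ord0 x = A o1 j by rewrite !mxE -jx.
have Cx' : corner A ord0 x' = A o1 j' by rewrite !mxE -jx'.
rewrite Cx Cx' in Qx.
have TP : c * (A ord0 j' * A o1 j) <= A ord0 j * A o1 j'.
  by apply: A2.2; rewrite ?jj'.
have a1 := A2.1 ord0 j; have a2 := A2.1 ord0 j'.
have a3 := A2.1 o1 j; have a4 := A2.1 o1 j'.
move: B0 Bj Bj' Sx Sx' Qx; set B0 := \det (col' ord0 A).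
set Bj := \det (col' j A); set Bj' := \det (col' j' A).
set Sx := \det (col' x _); set Sx' := \det (col' x' _).
move=> B0p Bjp Bj'p Sxp Sx'p Qx plu.
have BX : 0 < B0 * X by rewrite mulr_gt0.
have le1 : Bj' * Sx <= Bj * Sx' by lra.
rewrite -(ler_pM2r Sxp).
have h1 := ler_wpM2l (ltW a2) le1.
apply: (@le_trans _ _ (A ord0 j' * (Bj * Sx'))); first lra.
rewrite -(ler_pM2l a4).
have aB : 0 < A ord0 j' * Bj by rewrite mulr_gt0.
have h2 := ler_wpM2l (ltW aB) Qx.
apply: (@le_trans _ _ (A ord0 j' * Bj * (c * (A o1 j * Sx)))); first lra.
have BS : 0 < Bj * Sx by rewrite mulr_gt0.
have h3 := ler_wpM2l (ltW BS) TP.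
have aaBS : 0 <= A ord0 j * A o1 j' * (Bj * Sx) by rewrite !mulr_ge0 // ltW.
have h4 := ler_wpM2l aaBS c1.
lra.
Qed.

(** Decay of minors of order [n + 1] needs [pivot c n.+1 >= 0], hence admissibility
    one step further than the determinant bounds use. *)
Lemma pivot_bounds_minor_decay (R : realFieldType) (c : R) n :
  1 <= c -> admissible c n.+1 -> pivot_bounds c n /\ minor_decay c n.
Proof.
move=> c1; elim: n => [|n IHn] adm.
  have P0 : pivot_bounds c 0.
    by move=> M M2; rewrite /corner det_mx00 det_mx11 /= !mulr1 mul1r lexx.
  split=> // A A2 j j' jj'.
  have j0 : j = 0%N :> nat by have := ltn_ord j'; lia.
  have -> : j = ord0 by apply: val_inj.
  have -> : j' = o1 by apply: val_inj; rewrite /= jj' j0.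
  by apply: minor_decay_first => //; lra.
have [P Q] := IHn (admissible_pred _ _ _ adm).
have t0 := admissible_gt0 _ _ _ n adm (leqnSn _).
have P' := pivot_bounds_step _ _ _ c1 t0 P Q.
by split=> //; apply: minor_decay_step.
Qed.

(** Only [pivot_bounds_step] is used for the last size: decay of the minors of
    the same order would require [pivot c n.+1] to be positive, which fails at
    the critical [c]. *)
Lemma det_ge0_admissible (R : realFieldType) (c : R) n (M : 'M[R]_n.+2) :
  1 <= c -> admissible c n.+1 -> wide_TP2 c M -> 0 <= \det M.
Proof.
move=> c1 adm M2; have [P Q] := pivot_bounds_minor_decay _ _ _ c1 adm.
have t0 := admissible_gt0 _ _ _ n adm (ltnSn _).
have [m0 _] := pivot_bounds_step _ _ _ c1 t0 P Q _ M2; apply: le_trans.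
by rewrite !mulr_ge0 ?adm.2 // ltW // M2.1.
Qed.

(** Even if the last pivot vanishes, a strict inequality in the top left block
    makes the final comparison strict, because [D''] is positive. *)
Lemma det_gt0_admissible (R : realFieldType) (c : R) n (M : 'M[R]_n.+2) :
  1 <= c -> admissible c n.+1 -> wide_TP2 c M ->
  c * (M ord0 o1 * M o1 ord0) < M ord0 ord0 * M o1 o1 -> 0 < \det M.
Proof.
move=> c1 adm M2 strict; have [P Q] := pivot_bounds_minor_decay _ _ _ c1 adm.
have t0 := admissible_gt0 _ _ _ n adm (ltnSn _).
have c0 : 0 < c by lra.
have ct1 := admissible_mul_ge1 _ _ _ c0 adm.
have /andP[lower _] := det_three_term_bounds _ _ _ _ c1 t0 P Q M2.
apply: lt_le_trans lower; rewrite subr_gt0.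
have [D0 _] := P _ (wide_TP2_corner _ _ _ _ _ M2).
have -> : corner M ord0 ord0 = M o1 o1 by rewrite !mxE.
set D := \det (corner (corner M)) in D0 *; set E := \det (corner M) => low.
rewrite -(ltr_pM2l c0).
have h1 := ltr_pM2r D0 (c * (M ord0 o1 * M o1 ord0)) (M ord0 ord0 * M o1 o1).
rewrite strict in h1.
apply: (@lt_le_trans _ _ (M ord0 ord0 * M o1 o1 * D)); first lra.
have a0 := M2.1 ord0 ord0; have a1 := M2.1 o1 o1.
have h2 := ler_wpM2l (ltW (mulr_gt0 c0 a0)) low.
apply: le_trans (_ : c * M ord0 ord0 * (pivot c n * (M o1 o1 * D)) <= _); last lra.
have aaD : 0 < M ord0 ord0 * M o1 o1 * D by rewrite !mulr_gt0.
have := ler_wpM2l (ltW aaD) ct1; lra.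
Qed.

(** * The critical constant *)

(** With [s_m = sin (m x)], the recursion is [s_(m+1) = 2 cos x s_m - s_(m-1)]
    divided by [2 cos x s_m]. *)
Lemma pivot_sine (R : realType) (x : R) n :
  cos x != 0 -> (forall i, (i <= n)%N -> sin (i.+1%:R * x) != 0) ->
  pivot (4 * cos x ^+ 2) n = sin (n.+2%:R * x) / (2 * cos x * sin (n.+1%:R * x)).
Proof.
move=> cx0; elim: n => [|n IHn] s0.
  have s1 := s0 0%N (leqnn _); rewrite mul1r in s1 *.
  rewrite /= (_ : 2%:R * x = x + x) ?sinD; last by ring.
  by field; rewrite cx0 s1.
rewrite /= IHn; last by move=> i ni; apply: s0; lia.
have s1 := s0 n (leqnSn _); have s2 := s0 n.+1 (leqnn _).
have -> : sin (n.+3%:R * x) = 2 * cos x * sin (n.+2%:R * x) - sin (n.+1%:R * x).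
  rewrite (_ : n.+3%:R * x = n.+2%:R * x + x); last by rewrite -[n.+3]addn1 natrD; ring.
  rewrite (_ : n.+1%:R * x = n.+2%:R * x - x); last by rewrite -[n.+2]addn1 natrD; ring.
  by rewrite sinD sinB; ring.
by field; rewrite cx0 s1 s2.
Qed.

Lemma cos_pi_div_gt0 (R : realType) k : 0 < cos (pi / k.+3%:R : R).
Proof.
have pi0 := pi_gt0 R.
have k0 : 0 < k.+3%:R :> R by rewrite ltr0n.
apply: cos_gt0_pihalf; apply/andP; split.
  by apply: (@lt_trans _ _ 0); [lra | rewrite divr_gt0].
by rewrite ltr_pM2l // ltf_pV2 ?posrE // ltr_nat.
Qed.

Lemma admissible_cos (R : realType) k : admissible (c_ R k.+2) k.+1.
Proof.
set x : R := pi / k.+3%:R.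
have cx : 0 < cos x by exact: cos_pi_div_gt0.
have k0 : 0 < k.+3%:R :> R by rewrite ltr0n.
have x0 : 0 < x by rewrite divr_gt0 // pi_gt0.
have kx : k.+3%:R * x = pi by rewrite /x mulrC divfK // gt_eqF.
have sin_pos i : (i < k.+2)%N -> 0 < sin (i.+1%:R * x).
  move=> ik; apply: sin_gt0_pi; rewrite mulr_gt0 ?ltr0n //=.
  by rewrite -kx ltr_pM2r // ltr_nat.
have pivotE i : (i <= k.+1)%N -> pivot (c_ R k.+2) i
    = sin (i.+2%:R * x) / (2 * cos x * sin (i.+1%:R * x)).
  move=> ik; apply: pivot_sine; first by rewrite gt_eqF.
  by move=> l li; rewrite gt_eqF // sin_pos //; lia.
split=> [i ik|]; last by rewrite pivotE // kx sinpi mul0r.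
rewrite pivotE; last by lia.
by rewrite divr_gt0 ?mulr_gt0 ?sin_pos //; lia.
Qed.

(** [pivot c 1 = 1 - 1 / c] is nonnegative by admissibility. *)
Lemma c_ge1 (R : realType) k : 1 <= c_ R k.+2.
Proof.
have c0 : 0 < c_ R k.+2 by rewrite mulr_gt0 // exprn_gt0 // cos_pi_div_gt0.
have : 0 <= pivot (c_ R k.+2) 1.
  have [t0 t1] := admissible_cos R k.
  by case: k {c0} t0 t1 => // k t0 _; apply/ltW/t0.
by rewrite /= mulr1 subr_ge0 invf_le1.
Qed.

Theorem theorem1 (R : realType) (k : nat) (hk : (2 <= k)%N)
    (M : 'M[R]_k) (hM : positive_entries M) :
  (TP2 (c_ R k) M -> 0 <= \det M) /\ (STP2 (c_ R k) M -> 0 < \det M).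
Proof.
case: k hk M hM => [|[|k]] // _ M M0.
have c1 := c_ge1 R k; have adm := admissible_cos R k.
split=> [[_ M2]|[_ M2]].
  exact: (det_ge0_admissible _ _ _ _ c1 adm (wide_TP2_adjacent _ _ _ _ _ c1 M0 M2)).
have W : wide_TP2 (c_ R k.+2) M.
  by apply: (wide_TP2_adjacent _ _ _ _ _ c1 M0) => *; apply/ltW/M2.
by apply: (det_gt0_admissible _ _ _ _ c1 adm W); apply: M2.
Qed.
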